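(* After a suitable rotation, the cuboctahedron in $\mathbb{R}^3$ can be decomposed into ten pentahedra (convex polytopes with exactly 5 faces) with orthogonally connected boundaries.
   Context: A polygonal path in $\mathbb{R}^3$ is orthogonal if each of its edges is parallel to one of the coordinate axes. A set $S\subset\mathbb{R}^3$ is orthogonally connected if any two distinct points of $S$ are joined by an orthogonal path contained in $S$. A polytope is decomposed into polytopes $P_1,\dots,P_k$ if it is their union and their interiors are pairwise disjoint. Faces are the 2-dimensional faces. ''After a suitable rotation'' means that there is a rotation of $\mathbb{R}^3$ such that the image of the polytope has the stated property with respect to the fixed coordinate axes. The cuboctahedron is, up to similarity, the convex hull of all permutations of $(\pm1,\pm1,0)$ (8 triangular and 6 square faces). *)

(* Defs.v *)
From HB Require Import structures.
From mathcomp Require Import all_boot all_order all_algebra all_fingroup.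
From mathcomp Require Import all_classical all_reals all_analysis.

Set Implicit Arguments.
Unset Strict Implicit.
Unset Printing Implicit Defensive.

Import Order.TTheory GRing.Theory Num.Theory.
Import numFieldNormedType.Exports.

Local Open Scope classical_set_scope.
Local Open Scope ring_scope.

Section Space.
Variable R : realType.
Local Notation point := 'rV[R]_3.
Implicit Types (x y : point) (A C F P S V : set point).

Definition dot x y : R := \sum_(i < 3) x 0 i * y 0 i.

Definition segment x y : set point :=
  [set (1 - t) *: x + t *: y | t in `[0, 1]].

Definition boundary A : set point := closure A `\` A°.

(* A polygonal path is given by its first vertex [x] and the list [s] of its
   further vertices. *)
Definition axis_parallel x y : Prop :=
  exists (i : 'I_3) (t : R), t != 0 /\ y - x = t *: delta_mx 0 i.

Fixpoint orthogonal_path x (s : seq point) : Prop :=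
  if s is y :: s' then axis_parallel x y /\ orthogonal_path y s' else True.

Fixpoint path_support x (s : seq point) : set point :=
  if s is y :: s' then segment x y `|` path_support y s' else [set x].

Definition orthogonally_connected S : Prop :=
  forall x y, S x -> S y -> x <> y ->
    exists s : seq point,
      [/\ orthogonal_path x s, last x s = y & path_support x s `<=` S].

Definition convex_hull V : set point :=
  smallest [set A | @convex_set R point A] V.

Definition polytope P : Prop := exists2 V, finite_set V & P = convex_hull V.

Definition affinely_independent k (p : 'I_k.+1 -> point) : bool :=
  row_free (\matrix_(i < k) (p (lift ord0 i) - p ord0)).

Definition affine_dim_geq A k : Prop :=
  exists2 p : 'I_k.+1 -> point, (forall i, A (p i)) & affinely_independent p.

Definition affine_dim_eq A k : Prop :=
  affine_dim_geq A k /\ ~ affine_dim_geq A k.+1.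

(* Faces are the intersections with supporting planes that have dimension 2. *)
Definition is_face P F : Prop :=
  (exists (a : point) (b : R),
    [/\ a != 0, forall x, P x -> dot a x <= b
      & F = P `&` [set x | dot a x = b]])
  /\ affine_dim_eq F 2.

Definition pentahedron P : Prop :=
  polytope P /\ ([set F | is_face P F] #= `I_5)%card.

Definition decomposition k C (P : 'I_k -> set point) : Prop :=
  [/\ forall i, polytope (P i), C = \bigcup_i P i
    & trivIset setT (fun i => (P i)°)].

(* Points are row vectors, so a matrix acts on the right. *)
Definition orthogonal_mx (A : 'M[R]_3) : Prop := A *m A^T = 1%:M.

Definition rotation_mx (A : 'M[R]_3) : Prop := orthogonal_mx A /\ \det A = 1.

Definition rotate (A : 'M[R]_3) S : set point := [set x *m A | x in S].

Definition similarity (f : point -> point) : Prop :=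
  exists (c : R) (A : 'M[R]_3) (v : point),
    [/\ 0 < c, orthogonal_mx A & forall x, f x = c *: (x *m A) + v].

Definition cuboctahedron_vertices : set point :=
  [set x | exists (s : 'S_3) (a b : bool),
    x = col_perm s (\row_i [:: (-1) ^+ a; (-1) ^+ b; 0]`_i)].

Definition cuboctahedron C : Prop :=
  exists2 f, similarity f & C = f @` convex_hull cuboctahedron_vertices.

End Space.

(* Main.v *)
Require Import Defs.
From mathcomp Require Import all_boot all_order all_algebra all_fingroup.
From mathcomp Require Import all_classical all_reals all_analysis.
From mathcomp Require Import ring lra.

Set Implicit Arguments.
Unset Strict Implicit.
Unset Printing Implicit Defensive.

Import Order.TTheory GRing.Theory Num.Theory.
Import numFieldNormedType.Exports.

Local Open Scope classical_set_scope.
Local Open Scope ring_scope.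

(** A direction normal to a face must be orthogonal to some coordinate axis,
    since otherwise no axis-parallel segment stays in that face. Turning the
    cuboctahedron by 45 degrees about a 4-fold axis achieves this for all 14
    faces, and up to scaling along the axes it becomes the hull of the points
    (2 or -2, 0, 0), (0, 2 or -2, 0) and of the corners of the cube
    [-1, 1]^3. Such a scaling maps orthogonal paths to orthogonal paths, so the
    dissection can be described in this normal form.

    The planes of the vertical sides of the cube cut this solid into the cube
    and four square pyramids with apexes (2 or -2, 0, 0) and (0, 2 or -2, 0).
    At its apex such a pyramid has no axis-parallel segment in its boundary, so
    each one is halved by the plane z = 0: the face made by the cut contains the
    segment from the apex straight to the cube, and the half is a pyramid over a
    rectangle, thus a pentahedron. The cube is halved by the plane x = y into
    two triangular prisms. This makes 4 * 2 + 2 = 10 pieces.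

    Every piece is the image under a signed coordinate permutation and a
    translation of one of two models, [wedge] (half a pyramid) or [prism]. All
    the notions involved are affine invariants (lemmas
    [pentahedron_affine_image], [boundary_affine_image]), except orthogonal
    connectedness, for which the linear part has to permute the axes up to
    scaling ([orthogonally_connected_affine_image]). For the models, given by
    inequalities, the boundary is the union of the facets
    ([boundary_hpolytope]), the faces are exactly the facets
    ([card_faces_hpolytope]), and every boundary point is joined to a fixed one by at
    most four axis-parallel steps, each inside one facet. The pieces fill the
    solid ([turnedE]), and their interiors lie in disjoint regions
    ([open_region_disjoint]). *)

(** * Convex sets and affine images *)

Section Geometry.
Variable R : realType.
Local Notation point := 'rV[R]_3.
Implicit Types (x y p q a v : point) (A F P S V : set point) (L : 'M[R]_3).

Local Notation convex A := (@convex_set R point A).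

Lemma convexP A : convex A <->
  forall x y (t : R), 0 <= t <= 1 -> A x -> A y -> A (t *: x + (1 - t) *: y).
Proof.
split=> [cA x y t /andP[t0 t1] Ax Ay|cA x y t].
  by have := cA x y (Itv01 t0 t1); rewrite !inE; apply.
by rewrite !inE => Ax Ay; apply: cA => //; rewrite ge0 le1.
Qed.

Lemma convex_comb3 A p q r (a b c : R) : convex A ->
  0 <= a -> 0 <= b -> 0 <= c -> a + b + c = 1 -> A p -> A q -> A r ->
  A (a *: p + b *: q + c *: r).
Proof.
move=> /convexP cA a0 b0 c0 abc Ap Aq Ar.
have [ab0|ab0] := eqVneq (a + b) 0.
  have -> : a = 0 by lra.
  have -> : b = 0 by lra.
  have -> : c = 1 by lra.
  by rewrite !scale0r !add0r scale1r.
have ab : 0 < a + b by rewrite lt_neqAle eq_sym ab0 addr_ge0.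
have -> : a *: p + b *: q + c *: r =
    (a + b) *: ((a / (a + b)) *: p + (1 - a / (a + b)) *: q)
    + (1 - (a + b)) *: r.
  rewrite scalerDr !scalerA; congr (_ *: _ + _ *: _ + _ *: _); [field|field|lra].
  by [].
  by [].
apply: (cA) => //; first by lra.
by apply: cA => //; rewrite divr_ge0 ?(ltW ab)//= ler_pdivrMr// mul1r; lra.
Qed.

Lemma convex_hull_convex V : convex (convex_hull V).
Proof.
apply/convexP => x y t t01 Vx Vy B [cB VB].
by have /convexP := cB; apply=> //; [exact: Vx|exact: Vy].
Qed.

Lemma segment_subset_convex A x y : convex A -> A x -> A y -> segment x y `<=` A.
Proof.
move=> /convexP cA Ax Ay p [t]; rewrite /= in_itv/= => /andP[t0 t1] <-.
by rewrite addrC; apply: cA => //; rewrite t0.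
Qed.

(** The linear part is kept as a matrix because normals and the rank condition
    for independence transform through it. *)
Definition affine_map L v x := x *m L + v.

Lemma affine_map_convex_comb L v x y (t : R) :
  affine_map L v (t *: x + (1 - t) *: y) =
  t *: affine_map L v x + (1 - t) *: affine_map L v y.
Proof.
rewrite /affine_map mulmxDl -!scalemxAl !scalerDr addrACA -scalerDl.
by rewrite addrCA subrr addr0 scale1r.
Qed.

Lemma convex_affine_preimage L v A : convex A -> convex (affine_map L v @^-1` A).
Proof.
move=> /convexP cA; apply/convexP => x y t t01 Ax Ay /=.
by rewrite affine_map_convex_comb; apply: cA.
Qed.

Lemma convex_affine_image L v A : convex A -> convex (affine_map L v @` A).
Proof.
move=> /convexP cA; apply/convexP => _ _ t t01 [x Ax <-] [y Ay <-].
by exists (t *: x + (1 - t) *: y); [exact: cA|exact: affine_map_convex_comb].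
Qed.

Lemma image_convex_hull_subset L v V A : convex A ->
  affine_map L v @` V `<=` A -> affine_map L v @` convex_hull V `<=` A.
Proof.
move=> cA VA _ [x Vx <-].
suff: convex_hull V `<=` affine_map L v @^-1` A by exact.
apply: smallest_sub; first exact: convex_affine_preimage.
by move=> y Vy; apply: VA; exists y.
Qed.

Lemma image_convex_hull L v V :
  affine_map L v @` convex_hull V = convex_hull (affine_map L v @` V).
Proof.
apply/seteqP; split.
  by apply: image_convex_hull_subset;
    [exact: convex_hull_convex|exact: sub_gen_smallest].
apply: smallest_sub.
  by apply: convex_affine_image; exact: convex_hull_convex.
by apply: image_subset; exact: sub_gen_smallest.
Qed.

Lemma polytope_affine_image L v P : polytope P -> polytope (affine_map L v @` P).
Proof.
move=> [V Vfin ->]; exists (affine_map L v @` V); first exact: finite_image.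
exact: image_convex_hull.
Qed.

Lemma affine_mapK L v : L \in unitmx ->
  cancel (affine_map L v) (affine_map (invmx L) (- (v *m invmx L))).
Proof.
by move=> uL x; rewrite /affine_map mulmxDl mulmxK// -addrA subrr addr0.
Qed.

Lemma affine_mapVK L v : L \in unitmx ->
  cancel (affine_map (invmx L) (- (v *m invmx L))) (affine_map L v).
Proof. by move=> uL x; rewrite /affine_map mulmxDl mulNmx !mulmxKV// subrK. Qed.

Lemma affine_image_preimage L v A : L \in unitmx ->
  affine_map L v @` A = affine_map (invmx L) (- (v *m invmx L)) @^-1` A.
Proof.
move=> uL; apply/seteqP; split=> [_ [x Ax <-]/=|y Ay]; first by rewrite affine_mapK.
by exists (affine_map (invmx L) (- (v *m invmx L)) y); rewrite ?affine_mapVK.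
Qed.

Lemma affine_map_inj L v : L \in unitmx -> injective (affine_map L v).
Proof. by move=> uL; apply: can_inj (affine_mapK v uL). Qed.

Lemma affine_imageK L v A : L \in unitmx ->
  affine_map (invmx L) (- (v *m invmx L)) @` (affine_map L v @` A) = A.
Proof.
move=> uL; rewrite image_comp; apply/seteqP; split=> [_ [x Ax <-]|x Ax] /=.
  by rewrite affine_mapK.
by exists x => //=; rewrite affine_mapK.
Qed.

(** * Interiors and boundaries of affine images *)

Lemma sum3 (W : zmodType) (f : 'I_3 -> W) : \sum_(i < 3) f i = f 0 + f 1 + f 2%:R.
Proof.
rewrite !big_ord_recl big_ord0 addr0 addrA.
by congr (_ + f _ + f _); apply/val_inj.
Qed.

Lemma coord_sum_continuous (W : normedModType R) (f : 'I_3 -> W) :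
  continuous (fun x => \sum_(i < 3) x 0 i *: f i).
Proof.
have -> : (fun x => \sum_(i < 3) x 0 i *: f i) =
    fun x : point => x 0 0 *: f 0 + x 0 1 *: f 1 + x 0 2%:R *: f 2%:R.
  by apply/funext => x; rewrite sum3.
have coord i w : continuous (fun x : point => x 0 i *: (w : W)).
  move=> x; apply: (@cvgZr_tmp R W _ (nbhs (x : point))).
  exact: (@coord_continuous R 1 3 0 i x).
move=> x; apply: (@cvgD R W _ (nbhs (x : point))); last exact: coord.
by apply: (@cvgD R W _ (nbhs (x : point))); exact: coord.
Qed.

Lemma affine_map_continuous L v : continuous (affine_map L v).
Proof.
have -> : affine_map L v = (fun y : point => \sum_(i < 3) y 0 i *: row i L + v).
  by apply/funext => y; rewrite /affine_map mulmx_sum_row.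
move=> x; apply: (@cvgD R point _ (nbhs (x : point))); last exact: cvg_cst.
exact: coord_sum_continuous.
Qed.

Lemma interior_affine_image L v A : L \in unitmx ->
  (affine_map L v @` A)° = affine_map L v @` A°.
Proof.
move=> uL.
have sub (M : 'M[R]_3) (w : point) (B : set point) : M \in unitmx ->
    affine_map M w @` B° `<=` (affine_map M w @` B)°.
  move=> uM; rewrite !affine_image_preimage// => x Bx.
  by apply: (affine_map_continuous Bx).
apply/seteqP; split; last exact: sub.
rewrite [X in _ `<=` X]affine_image_preimage// => x Ax /=.
rewrite -[A](affine_imageK v _ uL); apply: sub; first by rewrite unitmx_inv.
by exists x.
Qed.

(** In terms of interiors alone, the boundary commutes with every bijection
    that commutes with interiors. *)
Lemma boundaryE A : boundary A = ~` ((~` A)° `|` A°).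
Proof. by rewrite /boundary setCU interiorC setCK. Qed.

Lemma boundary_affine_image L v A : L \in unitmx ->
  boundary (affine_map L v @` A) = affine_map L v @` boundary A.
Proof.
move=> uL; rewrite !boundaryE.
have imC B : ~` (affine_map L v @` B) = affine_map L v @` (~` B).
  by rewrite !affine_image_preimage.
by rewrite imC !interior_affine_image// -image_setU imC.
Qed.

Lemma dotE x y : dot x y = (x *m y^T) 0 0.
Proof. by rewrite /dot mxE; apply: eq_bigr => i _; rewrite mxE. Qed.

Lemma dot_mulmx x y L : dot (x *m L) y = dot x (y *m L^T).
Proof. by rewrite !dotE trmx_mul trmxK mulmxA. Qed.

Lemma dotDr x y p : dot x (y + p) = dot x y + dot x p.
Proof. by rewrite !dotE linearD/= mulmxDr mxE. Qed.

Lemma dotZr x y (t : R) : dot x (t *: y) = t * dot x y.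
Proof. by rewrite !dotE linearZ/= -scalemxAr mxE. Qed.

Lemma dotBr x y p : dot x (y - p) = dot x y - dot x p.
Proof. by rewrite dotDr -scaleN1r dotZr mulN1r. Qed.

Lemma dot_gt0 a : a != 0 -> 0 < dot a a.
Proof.
move=> a0; rewrite lt_neqAle eq_sym; apply/andP; split; last first.
  by apply: sumr_ge0 => i _; rewrite -expr2 sqr_ge0.
apply: contra a0; rewrite psumr_eq0 => [/allP aa|i _]; last exact: sqr_ge0.
apply/eqP/rowP => i; apply/eqP; rewrite mxE.
by have := aa i (mem_index_enum i); rewrite mulf_eq0 orbb.
Qed.

Lemma dot_continuous a : continuous (dot a).
Proof.
have -> : dot a = (fun y : point => \sum_(i < 3) y 0 i *: (a 0 i : R^o)).
  by apply/funext => y; apply: eq_bigr => i _; rewrite mulrC.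
exact: (@coord_sum_continuous R^o).
Qed.

(** From an interior point one can still move a little in the direction of the
    normal [a], which increases [dot a]. *)
Lemma interior_dot_lt P a (b : R) x : a != 0 ->
  (forall y, P y -> dot a y <= b) -> P° x -> dot a x < b.
Proof.
move=> a0 Pb Px.
have cf : continuous (fun t : R => x + t *: a).
  move=> t; apply: (@cvgD R point _ (nbhs t)); first exact: cvg_cst.
  exact: scalel_continuous.
have : nbhs (0 : R) ((fun t : R => x + t *: a) @^-1` P).
  by apply: cf; rewrite scale0r addr0; exact: Px.
move=> /nbhs_ballP[e /= e0 eP].
have /eP/= : ball (0 : R) e (e / 2).
  by rewrite /ball/= sub0r normrN gtr0_norm; lra.
move=> /Pb; rewrite dotDr dotZr; apply: lt_le_trans.
by rewrite ltrDl mulr_gt0 ?dot_gt0//; lra.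
Qed.

(** * Intersections of half-spaces *)

Section HalfSpaces.
Variables (n : nat) (a : 'I_n -> point) (b : 'I_n -> R).
Hypothesis a_neq0 : forall i, a i != 0.

Definition hpolytope : set point := [set x | forall i, dot (a i) x <= b i].

Definition facet (i : 'I_n) : set point :=
  hpolytope `&` [set x | dot (a i) x = b i].

Lemma convex_hpolytope : convex hpolytope.
Proof.
apply/convexP => x y t /andP[t0 t1] Px Py i; rewrite dotDr !dotZr.
have := Px i; have := Py i; nra.
Qed.

Lemma convex_facet i : convex (facet i).
Proof.
apply/convexP => x y t t01 [Px xi] [Py yi]; split.
  by have /convexP := convex_hpolytope; apply.
by move: xi yi => /= xi yi; rewrite dotDr !dotZr xi yi; ring.
Qed.

Lemma closed_hpolytope : closed hpolytope.
Proof.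
have -> : hpolytope = \bigcap_i (dot (a i) @^-1` [set r | r <= b i]).
  by apply/seteqP; split=> x Px i => [_|]; [exact: Px|exact: (Px i I)].
apply: closed_bigI => i _; apply: closed_comp; last exact: closed_le.
by move=> x _; exact: dot_continuous.
Qed.

Lemma interior_hpolytope : hpolytope° = [set x | forall i, dot (a i) x < b i].
Proof.
apply/seteqP; split=> x Px.
  by move=> i; apply: interior_dot_lt Px => // y; apply.
have open_side i : nbhs x [set y | dot (a i) y < b i].
  have : nbhs (dot (a i) x) [set r | r < b i] by apply: lt_nbhsl; exact: Px.
  exact: dot_continuous.
have all_sides := filter_forall (@nbhs_filter point x) open_side.
suff: nbhs x hpolytope by [].
apply: (@filterS point (nbhs x) _ _ _ _ all_sides).
by move=> y Py i; apply/ltW/Py.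
Qed.

Lemma boundary_hpolytope : boundary hpolytope = \bigcup_i facet i.
Proof.
rewrite /boundary interior_hpolytope.
have /closure_id <- := closed_hpolytope.
apply/seteqP; split=> x.
  move=> [Px /existsNP[i /negP]]; rewrite -leNgt => bx; exists i => //; split=> //=.
  by apply/le_anti; rewrite bx Px.
by move=> [i _ [Px xi]]; split=> // /(_ i); rewrite xi ltxx.
Qed.

(** Three independent directions in the facet would all be orthogonal to the
    nonzero vector [a i]. *)
Lemma facet_affine_dim_lt3 i : ~ affine_dim_geq (facet i) 3.
Proof.
move=> [p pi pfree]; have /negP := a_neq0 i; apply.
rewrite -(inj_eq (@trmx_inj _ _ _)) trmx0.
have := pfree; rewrite /affinely_independent row_free_unit.
set M := (M in M \in unitmx) => uM.
rewrite -(mulKmx uM (a i)^T); apply/eqP.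
suff -> : M *m (a i)^T = 0 by rewrite mulmx0.
apply/colP => k; have [_ /= pk] := pi (lift ord0 k); have [_ /= p0] := pi ord0.
have := dotBr (a i) (p (lift ord0 k)) (p ord0); rewrite pk p0 subrr => pk0.
rewrite !mxE -[RHS]pk0 /dot; apply: eq_bigr => j _.
by rewrite !mxE mulrC.
Qed.

(** The vectors orthogonal to two independent directions form a line, so both
    normals are proportional. *)
Lemma plane_normal_unique (p : 'I_3 -> point) c d (r s : R) :
  affinely_independent p -> c != 0 -> d != 0 ->
  (forall k, dot c (p k) = r) -> (forall k, dot d (p k) = s) ->
  [set x | dot c x = r] = [set x | dot d x = s].
Proof.
rewrite /affinely_independent; set M := (M in row_free M) => freeM c0 d0 cp dp.
have rank_ker : \rank (kermx M^T) = 1%N.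
  by rewrite mxrank_ker mxrank_tr; move: freeM => /eqP ->.
have in_ker e t : (forall k, dot e (p k) = t) -> (e <= kermx M^T)%MS.
  move=> ep; apply/sub_kermxP/rowP => k.
  have := dotBr e (p (lift ord0 k)) (p ord0); rewrite !ep subrr => ek0.
  rewrite !mxE -[RHS]ek0; apply: eq_bigr => j _.
  by rewrite !mxE.
have cker := in_ker _ _ cp.
have /sub_rVP[t dE] : (d <= c)%MS.
  apply: submx_trans (in_ker _ _ dp) _.
  have := (mxrank_leqif_eq cker).2; rewrite rank_ker rank_rV c0 eqxx.
  by move=> /esym /andP[].
have t0 : t != 0 by apply: contra d0 => /eqP t0; rewrite dE t0 scale0r.
have dotd x : dot d x = t * dot c x by rewrite dE !dotE -scalemxAl mxE.
apply/seteqP; split=> x /= xr; first by rewrite dotd xr -(cp ord0) -dotd dp.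
by apply: (mulfI t0); rewrite -dotd xr -(cp ord0) -dotd dp.
Qed.

(** The centroid of three independent points of a face is not interior, hence
    some inequality is an equality there; it is then an equality at the three
    points, which determine the plane of the face. *)
Lemma face_hpolytope F : is_face hpolytope F -> exists i, F = facet i.
Proof.
move=> [[c [r [c0 Pc FE]]] [[p pF pfree] _]].
have pP k : hpolytope (p k) by have := pF k; rewrite FE => -[].
have pc k : dot c (p k) = r by have := pF k; rewrite FE => -[].
pose m := 3^-1 *: (\sum_(k < 3) p k).
have dotm e : dot e m = 3^-1 * \sum_(k < 3) dot e (p k).
  by rewrite /m !sum3 dotZr !dotDr.
have [i mi] : exists i, dot (a i) m = b i.
  apply: contrapT => /forallNP ne.
  have : hpolytope° m.
    rewrite interior_hpolytope => i; rewrite lt_neqAle; apply/andP; split.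
      by apply/eqP/ne.
    rewrite dotm sum3; have := pP 0 i; have := pP 1 i; have := pP 2%:R i; lra.
  by move=> /(interior_dot_lt c0 Pc); rewrite dotm sum3 !pc; lra.
exists i; rewrite FE /facet; congr (_ `&` _).
apply: (plane_normal_unique pfree) => // k.
have k012 : [\/ k = 0, k = 1 | k = 2%:R].
  case: k => -[|[|[|]]] // lt3; [apply: Or31|apply: Or32|apply: Or33];
  exact/val_inj.
move: mi; rewrite dotm sum3; have := pP 0 i; have := pP 1 i; have := pP 2%:R i.
by case: k012 => ->; lra.
Qed.

Lemma card_faces_hpolytope : injective facet ->
  (forall i, affine_dim_geq (facet i) 2) ->
  ([set F | is_face hpolytope F] #= `I_n)%card.
Proof.
move=> facet_inj facet_dim.
have -> : [set F | is_face hpolytope F] = facet @` [set: 'I_n].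
  apply/seteqP; split=> F; first by move=> /face_hpolytope[i ->]; exists i.
  move=> [i _ <-]; split; last by split; [|exact: facet_affine_dim_lt3].
  by exists (a i), (b i); split=> // x Px; apply: Px.
rewrite card_eq_sym; apply: card_eq_trans card_II _; rewrite card_eq_sym.
by apply: inj_card_eq => i j _ _; exact: facet_inj.
Qed.

End HalfSpaces.

(** * Affine equivariance of faces *)

Lemma affine_dim_geq_image L v A k : L \in unitmx ->
  affine_dim_geq A k -> affine_dim_geq (affine_map L v @` A) k.
Proof.
move=> uL [p Ap pfree]; exists (fun i => affine_map L v (p i)).
  by move=> i; exists (p i).
rewrite /affinely_independent.
set M := (M in row_free M); have -> : M = \matrix_i (p (lift ord0 i) - p ord0) *m L.
  apply/row_matrixP => i; rewrite row_mul !rowK mulmxBl.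
  by rewrite /affine_map opprD addrACA subrr addr0.
by rewrite /row_free mxrankMfree// row_free_unit.
Qed.

Lemma is_face_image L v P F : L \in unitmx ->
  is_face P F -> is_face (affine_map L v @` P) (affine_map L v @` F).
Proof.
move=> uL [[a [b [a0 Pb FE]]] [dim2 dim3]].
pose a' := a *m (invmx L)^T.
have dota' x : dot a' (affine_map L v x) = dot a x + dot a' v.
  by rewrite dotDr dot_mulmx trmxK mulmxK.
split; last split; last first.
- move=> /(affine_dim_geq_image (- (v *m invmx L)) (L := invmx L)).
  by rewrite unitmx_inv affine_imageK// => /(_ uL).
- exact: affine_dim_geq_image.
exists a', (b + dot a' v); split.
- apply: contra a0 => /eqP a'0.
  have uV : (invmx L)^T \in unitmx by rewrite unitmx_tr unitmx_inv.
  by rewrite -(mulmxK uV a) -/a' a'0 mul0mx.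
- by move=> _ [x Px <-]; rewrite dota' lerD2r Pb.
apply/seteqP; split=> [_ [x + <-]|_ [[x Px <-]] /=].
  by rewrite FE => -[Px /= xb]; split; [exists x|rewrite /= dota' xb].
by rewrite dota' => /addIr xb; exists x => //; rewrite FE.
Qed.

Lemma pentahedron_affine_image L v P : L \in unitmx ->
  pentahedron P -> pentahedron (affine_map L v @` P).
Proof.
move=> uL [Ppoly Pfaces]; split; first exact: polytope_affine_image.
apply: card_eq_trans Pfaces.
have -> : [set F | is_face (affine_map L v @` P) F] =
    (fun F => affine_map L v @` F) @` [set F | is_face P F].
  apply/seteqP; split=> [F Fface|_ [F Fface <-]]; last exact: is_face_image.
  exists (affine_map (invmx L) (- (v *m invmx L)) @` F).
    have uV : invmx L \in unitmx by rewrite unitmx_inv.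
    have := is_face_image (- (v *m invmx L)) uV Fface.
    by rewrite affine_imageK.
  rewrite image_comp; apply/seteqP; split=> [_ [x Fx <-]|x Fx] /=.
    by rewrite affine_mapVK.
  by exists x; rewrite //= affine_mapVK.
apply: inj_card_eq => F F' _ _ /(congr1 (image^~
  (affine_map (invmx L) (- (v *m invmx L))))).
by rewrite !affine_imageK.
Qed.

(** * Orthogonal paths *)

(** Unlike [orthogonally_connected], this relation allows equal end points,
    which makes it an equivalence on [S]. *)
Definition linked S x y : Prop :=
  exists s, [/\ orthogonal_path x s, last x s = y & path_support x s `<=` S].

Lemma segment_left x y : segment x y x.
Proof.
exists 0; last by rewrite subr0 scale1r scale0r addr0.
by rewrite /= in_itv/= lexx ler01.
Qed.

Lemma segmentC x y : segment x y = segment y x.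
Proof.
suff sub (u w : point) : segment u w `<=` segment w u by apply/seteqP; split; exact: sub.
move=> p [t]; rewrite /= in_itv/= => /andP[t0 t1] <-; exists (1 - t).
  by rewrite /= in_itv/=; apply/andP; split; lra.
by rewrite addrC subKr.
Qed.

Lemma linked_refl S x : S x -> linked S x x.
Proof. by move=> Sx; exists [::]; split=> // _ ->. Qed.

Lemma linked_trans S x y p : linked S x y -> linked S y p -> linked S x p.
Proof.
move=> [s [+ + +]] [s' [ys' <- Ss']].
elim: s x => [x _ /= -> //|z s IHs x /= [xz zs] sy Ss].
  by exists s'.
have [|s'' [zs'' s''p Ss'']] := IHs z zs sy; first by move=> q sq; apply: Ss; right.
exists (z :: s''); split=> // q [xq|]; last exact: Ss''.
by apply: Ss; left.
Qed.

(** A degenerate step, [t = 0], is accepted so that the steps through a facet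
    need no case distinction. *)
Lemma linked_step S x y (i : 'I_3) (t : R) :
  y - x = t *: delta_mx 0 i -> segment x y `<=` S -> linked S x y.
Proof.
move=> yx Sxy; have Sx := Sxy x (segment_left x y).
have [t0|t0] := eqVneq t 0.
  by have -> : y = x; [apply/subr0_eq; rewrite yx t0 scale0r|exact: linked_refl].
exists [:: y]; split=> //=; first by split=> //; exists i, t.
move=> p [/Sxy//|->]; apply: Sxy; rewrite segmentC; exact: segment_left.
Qed.

Lemma linked_sym S x y : linked S x y -> linked S y x.
Proof.
move=> [s [+ + +]].
elim: s x => [x _ /= -> Sy|z s IHs x /= [[i [t [t0 zx]]] zs] sy Ss].
  by apply: linked_refl; apply: Sy.
apply: (@linked_trans _ _ z).
  by apply: IHs => // p sp; apply: Ss; right.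
apply: (@linked_step _ _ _ i (- t)); first by rewrite scaleNr -zx opprB.
by rewrite segmentC => p xzp; apply: Ss; left.
Qed.

Lemma orthogonally_connected_linked S x0 :
  (forall x, S x -> linked S x x0) -> orthogonally_connected S.
Proof.
move=> hub x y Sx Sy _; apply: linked_trans (hub x Sx) _.
exact/linked_sym/hub.
Qed.

(** Coordinate axes go to coordinate axes, possibly rescaled: the linear maps
    that respect orthogonal paths. *)
Definition axis_preserving L : Prop :=
  forall i : 'I_3, exists (j : 'I_3) (c : R),
    c != 0 /\ delta_mx 0 i *m L = c *: delta_mx 0 j :> point.

Lemma segment_affine_image L v x y :
  segment (affine_map L v x) (affine_map L v y) = affine_map L v @` segment x y.
Proof.
have E (t : R) : affine_map L v ((1 - t) *: x + t *: y) =
    (1 - t) *: affine_map L v x + t *: affine_map L v y.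
  by rewrite addrC affine_map_convex_comb addrC.
apply/seteqP; split=> [_ [t t01 <-]|_ [_ [t t01 <-] <-]].
  by rewrite -E; exists ((1 - t) *: x + t *: y) => //; exists t.
by rewrite E; exists t.
Qed.

Lemma linked_affine_image L v S x y : axis_preserving L ->
  linked S x y -> linked (affine_map L v @` S) (affine_map L v x) (affine_map L v y).
Proof.
move=> axL [s [+ + +]].
elim: s x => [x _ /= -> Sy|z s IHs x /= [[i [t [t0 zx]]] zs] sy Ss].
  by apply: linked_refl; exists y => //; apply: Sy.
apply: (@linked_trans _ _ (affine_map L v z)); last first.
  by apply: IHs => // p sp; apply: Ss; right.
have [j [c [c0 Lij]]] := axL i.
apply: (@linked_step _ _ _ j (t * c)).
  by rewrite /affine_map opprD addrACA subrr addr0 -mulmxBl zx -scalemxAl Lij scalerA.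
by rewrite segment_affine_image; apply: image_subset => p xzp; apply: Ss; left.
Qed.

Lemma orthogonally_connected_affine_image L v S : axis_preserving L ->
  orthogonally_connected S -> orthogonally_connected (affine_map L v @` S).
Proof.
move=> axL Sconn _ _ [x Sx <-] [y Sy <-] xy.
by apply: linked_affine_image => //; apply: Sconn => // xy'; apply: xy; rewrite xy'.
Qed.

Lemma axis_preserving_monomial (d : point) (s : 'S_3) :
  (forall i, d 0 i != 0) -> axis_preserving (diag_mx d *m perm_mx s).
Proof.
move=> d0 i; exists (s i), (d 0 i); split=> //.
rewrite mulmxA -rowE row_diag_mx -scalemxAl; congr (_ *: _).
by rewrite -rowE; apply/rowP => j; rewrite !mxE eq_sym.
Qed.

Lemma unitmx_monomial (d : point) (s : 'S_3) :
  (forall i, d 0 i != 0) -> diag_mx d *m perm_mx s \in unitmx.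
Proof.
move=> d0; rewrite unitmx_mul unitmx_perm andbT unitmxE det_diag.
by rewrite unitfE; apply/prodf_neq0 => i _.
Qed.

End Geometry.

Section Coordinates.
Variable R : realType.
Local Notation point := 'rV[R]_3.
Implicit Types (x y z t : R) (p q r : point) (A S : set point).

Definition pt (x y z : R) : point := \row_i [:: x; y; z]`_i.

Lemma ptE x y z :
  (pt x y z 0 0 = x) * (pt x y z 0 1 = y) * (pt x y z 0 2%:R = z).
Proof. by rewrite /pt !mxE. Qed.

Lemma ord3P (Q : 'I_3 -> Prop) : Q 0 -> Q 1 -> Q 2%:R -> forall i, Q i.
Proof.
move=> Q0 Q1 Q2 [[|[|[|]]] // lt3]; [move: Q0|move: Q1|move: Q2];
by congr Q; apply/val_inj.
Qed.

Lemma eq_pt p q : p 0 0 = q 0 0 -> p 0 1 = q 0 1 -> p 0 2%:R = q 0 2%:R -> p = q.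
Proof. by move=> *; apply/rowP; apply: ord3P. Qed.

Lemma pt_eta p : p = pt (p 0 0) (p 0 1) (p 0 2%:R).
Proof. by apply: eq_pt; rewrite ptE. Qed.

Lemma dot_pt a b c x y z : dot (pt a b c) (pt x y z) = a * x + b * y + c * z.
Proof. by rewrite /dot sum3 !ptE. Qed.

Lemma addpt x y z x' y' z' : pt x y z + pt x' y' z' = pt (x + x') (y + y') (z + z').
Proof. by apply: eq_pt; rewrite mxE !ptE. Qed.

Lemma scalept t x y z : t *: pt x y z = pt (t * x) (t * y) (t * z).
Proof. by apply: eq_pt; rewrite mxE !ptE. Qed.

Lemma oppt x y z : - pt x y z = pt (- x) (- y) (- z).
Proof. by apply: eq_pt; rewrite mxE !ptE. Qed.

Lemma pt_inj x y z x' y' z' : pt x y z = pt x' y' z' -> [/\ x = x', y = y' & z = z'].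
Proof.
move=> E; split.
- by have := congr1 (fun p : point => p 0 0) E; rewrite !ptE.
- by have := congr1 (fun p : point => p 0 1) E; rewrite !ptE.
- by have := congr1 (fun p : point => p 0 2%:R) E; rewrite !ptE.
Qed.

Lemma pt_neq0 x y z : (x != 0) || (y != 0) || (z != 0) -> pt x y z != 0.
Proof.
apply: contraTN => /eqP E.
have -> : x = 0 by have := congr1 (fun p : point => p 0 0) E; rewrite ptE mxE.
have -> : y = 0 by have := congr1 (fun p : point => p 0 1) E; rewrite ptE mxE.
have -> : z = 0 by have := congr1 (fun p : point => p 0 2%:R) E; rewrite ptE mxE.
by rewrite eqxx.
Qed.

Lemma linked_x S x x' y z :
  segment (pt x y z) (pt x' y z) `<=` S -> linked S (pt x y z) (pt x' y z).
Proof.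
apply: (@linked_step _ _ _ _ 0 (x' - x)).
by rewrite oppt addpt; apply: eq_pt; rewrite !mxE ?eqxx /=; ring.
Qed.

Lemma linked_y S x y y' z :
  segment (pt x y z) (pt x y' z) `<=` S -> linked S (pt x y z) (pt x y' z).
Proof.
apply: (@linked_step _ _ _ _ 1 (y' - y)).
by rewrite oppt addpt; apply: eq_pt; rewrite !mxE ?eqxx /=; ring.
Qed.

Lemma linked_z S x y z z' :
  segment (pt x y z) (pt x y z') `<=` S -> linked S (pt x y z) (pt x y z').
Proof.
apply: (@linked_step _ _ _ _ 2%:R (z' - z)).
by rewrite oppt addpt; apply: eq_pt; rewrite !mxE ?eqxx /=; ring.
Qed.

Lemma affine_dim_geq2 A p q r : A p -> A q -> A r ->
  (forall s t : R, s *: (q - p) + t *: (r - p) = 0 -> s = 0 /\ t = 0) ->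
  affine_dim_geq A 2.
Proof.
move=> Ap Aq Ar indep; exists (fun i : 'I_3 => nth 0 [:: p; q; r] i).
  by apply: ord3P.
apply: inj_row_free => w; rewrite mulmx_sum_row !big_ord_recl big_ord0 addr0.
rewrite !rowK => /indep[w0 w1].
by apply/rowP => -[[|[|]] // lt2]; rewrite mxE; [rewrite -[RHS]w0|rewrite -[RHS]w1];
  congr (w _ _); apply/val_inj.
Qed.

(** A point of a facet on no other bounding plane tells it apart from all other
    facets. *)
Lemma facet_injective n (a : 'I_n -> point) (b : 'I_n -> R) :
  (forall i, exists2 x, facet a b i x & forall j, dot (a j) x = b j -> j = i) ->
  injective (facet a b).
Proof.
move=> sep i j ij; have [x xi only_i] := sep i.
by apply/esym/only_i; move: xi; rewrite ij => -[].
Qed.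

(** * The two model pentahedra *)

(** Half of a square pyramid: the apex is (1, 0, 0), the square face of the
    whole pyramid lies in the plane x = 0, and the cut in the plane z = 0. *)
Definition wedge_normal (i : 'I_5) : point :=
  nth 0 [:: pt (-1) 0 0; pt 0 0 (-1); pt 1 0 1; pt 1 1 0; pt 1 (-1) 0] i.

Definition wedge_bound (i : 'I_5) : R := nth 0 [:: 0; 0; 1; 1; 1] i.

Definition wedge := hpolytope wedge_normal wedge_bound.

(** Half of the cube [-1, 1]^3, below the diagonal plane x = y. *)
Definition prism_normal (i : 'I_5) : point :=
  nth 0 [:: pt 0 0 1; pt 0 0 (-1); pt 0 (-1) 0; pt 1 0 0; pt (-1) 1 0] i.

Definition prism_bound (i : 'I_5) : R := nth 0 [:: 1; 1; 1; 1; 0] i.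

Definition prism := hpolytope prism_normal prism_bound.

Definition wedge_vertices : set point :=
  [set` [:: pt 1 0 0; pt 0 1 0; pt 0 (-1) 0; pt 0 1 1; pt 0 (-1) 1]].

Definition prism_vertices : set point :=
  [set` [:: pt 1 (-1) 1; pt 1 1 1; pt (-1) (-1) 1;
            pt 1 (-1) (-1); pt 1 1 (-1); pt (-1) (-1) (-1)]].

Local Notation "#0" := (@Ordinal 5 0 isT).
Local Notation "#1" := (@Ordinal 5 1 isT).
Local Notation "#2" := (@Ordinal 5 2 isT).
Local Notation "#3" := (@Ordinal 5 3 isT).
Local Notation "#4" := (@Ordinal 5 4 isT).

Lemma ord5P (Q : 'I_5 -> Prop) : Q #0 -> Q #1 -> Q #2 -> Q #3 -> Q #4 ->
  forall i, Q i.
Proof.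
move=> Q0 Q1 Q2 Q3 Q4 [[|[|[|[|[|]]]]] // lt5];
  [move: Q0|move: Q1|move: Q2|move: Q3|move: Q4];
by congr Q; apply/val_inj.
Qed.

Lemma wedgeP x y z : wedge (pt x y z) <->
  [/\ 0 <= x, 0 <= z, x + z <= 1, x + y <= 1 & x - y <= 1].
Proof.
split=> [W|[x0 z0 xz xy x_y]]; last first.
  by apply: ord5P; rewrite dot_pt /wedge_bound /=; lra.
have := W #0; have := W #1; have := W #2; have := W #3; have := W #4.
by rewrite !dot_pt /wedge_bound /= => *; split; lra.
Qed.

Lemma prismP x y z : prism (pt x y z) <->
  [/\ z <= 1, -1 <= z, -1 <= y, x <= 1 & y <= x].
Proof.
split=> [W|[z1 z_1 y1 x1 xy]]; last first.
  by apply: ord5P; rewrite dot_pt /prism_bound /=; lra.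
have := W #0; have := W #1; have := W #2; have := W #3; have := W #4.
by rewrite !dot_pt /prism_bound /= => *; split; lra.
Qed.

Lemma wedge_normal_neq0 i : wedge_normal i != 0.
Proof.
by move: i; apply: ord5P; apply: pt_neq0; rewrite ?oppr_eq0 ?oner_eq0 ?orbT.
Qed.

Lemma prism_normal_neq0 i : prism_normal i != 0.
Proof.
by move: i; apply: ord5P; apply: pt_neq0; rewrite ?oppr_eq0 ?oner_eq0 ?orbT.
Qed.

Lemma wedge_facetP i x y z : facet wedge_normal wedge_bound i (pt x y z) <->
  wedge (pt x y z) /\ nth True [:: x = 0; z = 0; x + z = 1; x + y = 1; x - y = 1] i.
Proof.
by split=> -[W xi]; split=> //; move: xi; rewrite /= /wedge_normal /wedge_bound;
  move: i; apply: ord5P => /=; rewrite dot_pt; lra.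
Qed.

Lemma prism_facetP i x y z : facet prism_normal prism_bound i (pt x y z) <->
  prism (pt x y z) /\ nth True [:: z = 1; z = -1; y = -1; x = 1; x = y] i.
Proof.
by split=> -[W xi]; split=> //; move: xi; rewrite /= /prism_normal /prism_bound;
  move: i; apply: ord5P => /=; rewrite dot_pt; lra.
Qed.

Local Ltac in_wedge_facet :=
  apply/wedge_facetP; rewrite wedgeP /=; (split; [split|]; lra).

Local Ltac in_prism_facet :=
  apply/prism_facetP; rewrite prismP /=; (split; [split|]; lra).

Lemma wedge_facet_inj : injective (facet wedge_normal wedge_bound).
Proof.
apply: facet_injective; apply: ord5P.
- exists (pt 0 0 2^-1); first by in_wedge_facet.
  by apply: ord5P; rewrite dot_pt /wedge_bound //= => ?; exfalso; lra.
- exists (pt 2^-1 0 0); first by in_wedge_facet.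
  by apply: ord5P; rewrite dot_pt /wedge_bound //= => ?; exfalso; lra.
- exists (pt 2^-1 0 2^-1); first by in_wedge_facet.
  by apply: ord5P; rewrite dot_pt /wedge_bound //= => ?; exfalso; lra.
- exists (pt 2^-1 2^-1 4^-1); first by in_wedge_facet.
  by apply: ord5P; rewrite dot_pt /wedge_bound //= => ?; exfalso; lra.
- exists (pt 2^-1 (- 2^-1) 4^-1); first by in_wedge_facet.
  by apply: ord5P; rewrite dot_pt /wedge_bound //= => ?; exfalso; lra.
Qed.

Lemma prism_facet_inj : injective (facet prism_normal prism_bound).
Proof.
apply: facet_injective; apply: ord5P.
- exists (pt 2^-1 (- 2^-1) 1); first by in_prism_facet.
  by apply: ord5P; rewrite dot_pt /prism_bound //= => ?; exfalso; lra.
- exists (pt 2^-1 (- 2^-1) (-1)); first by in_prism_facet.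
  by apply: ord5P; rewrite dot_pt /prism_bound //= => ?; exfalso; lra.
- exists (pt 0 (-1) 0); first by in_prism_facet.
  by apply: ord5P; rewrite dot_pt /prism_bound //= => ?; exfalso; lra.
- exists (pt 1 0 0); first by in_prism_facet.
  by apply: ord5P; rewrite dot_pt /prism_bound //= => ?; exfalso; lra.
- exists (pt 0 0 0); first by in_prism_facet.
  by apply: ord5P; rewrite dot_pt /prism_bound //= => ?; exfalso; lra.
Qed.

Lemma affine_dim_geq2_pt A (x0 y0 z0 x1 y1 z1 x2 y2 z2 : R) :
  A (pt x0 y0 z0) -> A (pt x1 y1 z1) -> A (pt x2 y2 z2) ->
  (forall s t, s * (x1 - x0) + t * (x2 - x0) = 0 ->
    s * (y1 - y0) + t * (y2 - y0) = 0 -> s * (z1 - z0) + t * (z2 - z0) = 0 ->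
    s = 0 /\ t = 0) ->
  affine_dim_geq A 2.
Proof.
move=> A0 A1 A2 indep; apply: (affine_dim_geq2 A0 A1 A2) => s t.
rewrite !oppt !addpt !scalept addpt => E.
have := congr1 (fun p : point => p 0 0) E; rewrite ptE mxE => ?.
have := congr1 (fun p : point => p 0 1) E; rewrite ptE mxE => ?.
have := congr1 (fun p : point => p 0 2%:R) E; rewrite ptE mxE => ?.
exact: indep.
Qed.

Lemma wedge_facet_dim i : affine_dim_geq (facet wedge_normal wedge_bound i) 2.
Proof.
move: i; apply: ord5P; [
  apply: (@affine_dim_geq2_pt _ 0 1 0 0 (-1) 0 0 1 1)
| apply: (@affine_dim_geq2_pt _ 1 0 0 0 1 0 0 (-1) 0)
| apply: (@affine_dim_geq2_pt _ 1 0 0 0 1 1 0 (-1) 1)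
| apply: (@affine_dim_geq2_pt _ 1 0 0 0 1 0 0 1 1)
| apply: (@affine_dim_geq2_pt _ 1 0 0 0 (-1) 0 0 (-1) 1)];
solve [ by in_wedge_facet
      | by move=> s t *; split; lra].
Qed.

Lemma prism_facet_dim i : affine_dim_geq (facet prism_normal prism_bound i) 2.
Proof.
move: i; apply: ord5P; [
  apply: (@affine_dim_geq2_pt _ 1 (-1) 1 1 1 1 (-1) (-1) 1)
| apply: (@affine_dim_geq2_pt _ 1 (-1) (-1) 1 1 (-1) (-1) (-1) (-1))
| apply: (@affine_dim_geq2_pt _ 1 (-1) 1 (-1) (-1) 1 1 (-1) (-1))
| apply: (@affine_dim_geq2_pt _ 1 (-1) 1 1 1 1 1 (-1) (-1))
| apply: (@affine_dim_geq2_pt _ 1 1 1 (-1) (-1) 1 1 1 (-1))];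
solve [ by in_prism_facet
      | by move=> s t *; split; lra].
Qed.

Lemma convex_segment_pt A x y z x1 y1 z1 x2 y2 z2 t : @convex_set R point A ->
  0 <= t <= 1 -> A (pt x1 y1 z1) -> A (pt x2 y2 z2) ->
  x = t * x1 + (1 - t) * x2 -> y = t * y1 + (1 - t) * y2 ->
  z = t * z1 + (1 - t) * z2 -> A (pt x y z).
Proof.
move=> /convexP cA t01 A1 A2 -> -> ->.
by have := cA _ _ _ t01 A1 A2; rewrite !scalept addpt.
Qed.

Lemma convex_triangle_pt A x y z (x1 y1 z1 x2 y2 z2 x3 y3 z3 a b c : R) :
  @convex_set R point A -> 0 <= a -> 0 <= b -> 0 <= c -> a + b + c = 1 ->
  A (pt x1 y1 z1) -> A (pt x2 y2 z2) -> A (pt x3 y3 z3) ->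
  x = a * x1 + b * x2 + c * x3 -> y = a * y1 + b * y2 + c * y3 ->
  z = a * z1 + b * z2 + c * z3 -> A (pt x y z).
Proof.
move=> cA a0 b0 c0 abc A1 A2 A3 -> -> ->.
by have := convex_comb3 cA a0 b0 c0 abc A1 A2 A3; rewrite !scalept !addpt.
Qed.

(** A line parallel to the y-axis leaves the wedge through its two triangular
    sides x + y = 1 and x - y = 1, where barycentric coordinates are explicit. *)
Lemma wedge_hull : wedge = convex_hull wedge_vertices.
Proof.
apply/seteqP; split; last first.
  apply: smallest_sub; first exact: convex_hpolytope.
  move=> p; rewrite /wedge_vertices /= !inE.
  move=> /or4P[/eqP->|/eqP->|/eqP->|/orP[]/eqP->];
  by apply/wedgeP; split; lra.
move=> p; rewrite (pt_eta p); move: (p 0 0) (p 0 1) (p 0 2%:R) => x y z.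
move=> /wedgeP[x0 z0 xz xy x_y].
have cH := @convex_hull_convex R wedge_vertices.
have vH (v : point) : v \in [:: pt 1 0 0; pt 0 1 0; pt 0 (-1) 0; pt 0 1 1; pt 0 (-1) 1] ->
    convex_hull wedge_vertices v by move=> vV; apply: sub_gen_smallest.
have side1 : convex_hull wedge_vertices (pt x (1 - x) z).
  apply: (@convex_triangle_pt _ _ _ _ 1 0 0 0 1 0 0 1 1 x (1 - x - z) z cH);
  solve [by lra | by apply: vH; rewrite !inE eqxx ?orbT].
have side2 : convex_hull wedge_vertices (pt x (x - 1) z).
  apply: (@convex_triangle_pt _ _ _ _ 1 0 0 0 (-1) 0 0 (-1) 1 x (1 - x - z) z cH);
  solve [by lra | by apply: vH; rewrite !inE eqxx ?orbT].
(* At the apex the line degenerates, and [t] below would divide by zero. *)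
have [x1|x1] := eqVneq x 1.
  by have -> : y = 1 - x by lra.
have x1' : 0 < 1 - x by lra.
pose t := (y + (1 - x)) / (2 * (1 - x)).
apply: (@convex_segment_pt _ _ _ _ _ _ _ _ _ _ t cH _ side1 side2).
- by rewrite /t divr_ge0 ?ler_pdivrMr //=; lra.
- by ring.
- by rewrite /t; field; lra.
- by ring.
Qed.

(** Each point lies between two points of the horizontal triangles, where
    barycentric coordinates are explicit. *)
Lemma prism_hull : prism = convex_hull prism_vertices.
Proof.
apply/seteqP; split; last first.
  apply: smallest_sub; first exact: convex_hpolytope.
  move=> p; rewrite /prism_vertices /= !inE.
  move=> /or4P[/eqP->|/eqP->|/eqP->|/or3P[]/eqP->];
  by apply/prismP; split; lra.
move=> p; rewrite (pt_eta p); move: (p 0 0) (p 0 1) (p 0 2%:R) => x y z.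
move=> /prismP[z1 z_1 y1 x1 xy].
have cH := @convex_hull_convex R prism_vertices.
have vH (v : point) : v \in [:: pt 1 (-1) 1; pt 1 1 1; pt (-1) (-1) 1;
            pt 1 (-1) (-1); pt 1 1 (-1); pt (-1) (-1) (-1)] ->
    convex_hull prism_vertices v by move=> vV; apply: sub_gen_smallest.
have top : convex_hull prism_vertices (pt x y 1).
  apply: (@convex_triangle_pt _ _ _ _ 1 (-1) 1 1 1 1 (-1) (-1) 1
    ((x - y) / 2) ((y + 1) / 2) ((1 - x) / 2) cH);
  solve [by lra | by apply: vH; rewrite !inE eqxx ?orbT].
have bottom : convex_hull prism_vertices (pt x y (-1)).
  apply: (@convex_triangle_pt _ _ _ _ 1 (-1) (-1) 1 1 (-1) (-1) (-1) (-1)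
    ((x - y) / 2) ((y + 1) / 2) ((1 - x) / 2) cH);
  solve [by lra | by apply: vH; rewrite !inE eqxx ?orbT].
by apply: (@convex_segment_pt _ _ _ _ _ _ _ _ _ _ ((1 + z) / 2) cH _ top bottom); lra.
Qed.

Lemma pentahedron_wedge : pentahedron wedge.
Proof.
split; first by exists wedge_vertices; [exact: finite_seq|exact: wedge_hull].
apply: card_faces_hpolytope wedge_facet_inj wedge_facet_dim.
exact: wedge_normal_neq0.
Qed.

Lemma pentahedron_prism : pentahedron prism.
Proof.
split; first by exists prism_vertices; [exact: finite_seq|exact: prism_hull].
apply: card_faces_hpolytope prism_facet_inj prism_facet_dim.
exact: prism_normal_neq0.
Qed.

(** The hub is the midpoint of the edge between the facets x = 0 and z = 0;
    the latter is called the base. The vertical facets are swept by z-segments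
    ending on the base, and the sloping facet by y-segments ending on a vertical
    one. *)
Lemma wedge_boundary_connected : orthogonally_connected (boundary wedge).
Proof.
rewrite boundary_hpolytope; last exact: wedge_normal_neq0.
set S := \bigcup_i _.
have seg i p q : facet wedge_normal wedge_bound i p ->
    facet wedge_normal wedge_bound i q -> segment p q `<=` S.
  move=> pi qi r pqr; exists i => //.
  by move: r pqr; apply: segment_subset_convex => //; exact: convex_facet.
apply: (@orthogonally_connected_linked _ _ (pt 0 0 0)) => p [i _].
rewrite (pt_eta p); move: (p 0 0) (p 0 1) (p 0 2%:R) => {p} x y z.
(* Within the base, the x-axis is reached first: the apex sees no other
   direction. *)
have base x' y' : wedge (pt x' y' 0) -> linked S (pt x' y' 0) (pt 0 0 0).
  move=> /wedgeP[? ? ? ? ?]; apply: (@linked_trans _ _ _ (pt x' 0 0)).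
    by apply/linked_y/(seg #1); in_wedge_facet.
  by apply/linked_x/(seg #1); in_wedge_facet.
have drop j x' y' z' : j \in [:: #0; #3; #4] ->
    facet wedge_normal wedge_bound j (pt x' y' z') ->
    linked S (pt x' y' z') (pt 0 0 0).
  rewrite !inE => jV /wedge_facetP[/wedgeP[? ? ? ? ?] xj].
  apply: (@linked_trans _ _ _ (pt x' y' 0)); last by apply/base/wedgeP; split; lra.
  by apply/linked_z/(seg j); apply/wedge_facetP; rewrite wedgeP;
    (split; first by split; lra); move: jV xj => /or3P[]/eqP-> /=; lra.
move: i; apply: ord5P => F.
- exact: (drop #0).
- by move: F => /wedge_facetP[W /= z0]; move: W; rewrite z0; exact: base.
- move: F => /wedge_facetP[/wedgeP[? ? ? ? ?] /= ?].
  apply: (@linked_trans _ _ _ (pt x (1 - x) z)).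
    by apply/linked_y/(seg #2); in_wedge_facet.
  by apply: (drop #3) => //; in_wedge_facet.
- exact: (drop #3).
- exact: (drop #4).
Qed.

(** The facet x = 1 is hit by the x-segments of the three other facets that
    contain this direction; the diagonal facet is swept by z-segments ending on
    the bottom one. *)
Lemma prism_boundary_connected : orthogonally_connected (boundary prism).
Proof.
rewrite boundary_hpolytope; last exact: prism_normal_neq0.
set S := \bigcup_i _.
have seg i p q : facet prism_normal prism_bound i p ->
    facet prism_normal prism_bound i q -> segment p q `<=` S.
  move=> pi qi r pqr; exists i => //.
  by move: r pqr; apply: segment_subset_convex => //; exact: convex_facet.
apply: (@orthogonally_connected_linked _ _ (pt 1 (-1) (-1))) => p [i _].
rewrite (pt_eta p); move: (p 0 0) (p 0 1) (p 0 2%:R) => {p} x y z.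
have right y' z' : prism (pt 1 y' z') -> linked S (pt 1 y' z') (pt 1 (-1) (-1)).
  move=> /prismP[? ? ? ? ?]; apply: (@linked_trans _ _ _ (pt 1 (-1) z')).
    by apply/linked_y/(seg #3); in_prism_facet.
  by apply/linked_z/(seg #3); in_prism_facet.
have slide j x' y' z' : j \in [:: #0; #1; #2] ->
    facet prism_normal prism_bound j (pt x' y' z') ->
    linked S (pt x' y' z') (pt 1 (-1) (-1)).
  rewrite !inE => jV /prism_facetP[/prismP[? ? ? ? ?] xj].
  apply: (@linked_trans _ _ _ (pt 1 y' z')); last by apply/right/prismP; split; lra.
  by apply/linked_x/(seg j); apply/prism_facetP; rewrite prismP;
    (split; first by split; lra); move: jV xj => /or3P[]/eqP-> /=; lra.
move: i; apply: ord5P => F.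
- exact: (slide #0).
- exact: (slide #1).
- exact: (slide #2).
- by move: F => /prism_facetP[W /= x1]; move: W; rewrite x1; exact: right.
- move: F => /prism_facetP[/prismP[? ? ? ? ?] /= ?].
  apply: (@linked_trans _ _ _ (pt x y (-1))).
    by apply/linked_z/(seg #4); in_prism_facet.
  by apply: (slide #1) => //; in_prism_facet.
Qed.

End Coordinates.

(** * The ten pieces *)

Section Dissection.
Variable R : realType.
Local Notation point := 'rV[R]_3.
Local Notation label := (bool * bool * bool + bool)%type.
Implicit Types (x y z : R) (p q : point) (a b c e s : bool) (i j : label).

Definition swap_perm b : 'S_3 := if b then tperm 0 1 else 1%g.

Definition axis_mx (d : point) b : 'M[R]_3 := diag_mx d *m perm_mx (swap_perm b).

Lemma pt_axis_mx x y z (c1 c2 c3 : R) b : pt x y z *m axis_mx (pt c1 c2 c3) b =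
  if b then pt (y * c2) (x * c1) (z * c3) else pt (x * c1) (y * c2) (z * c3).
Proof.
have -> : pt x y z *m axis_mx (pt c1 c2 c3) b =
    col_perm (swap_perm b) (pt (x * c1) (y * c2) (z * c3)).
  have -> : swap_perm b = (swap_perm b)^-1%g by case: b; rewrite /= ?tpermV ?invg1.
  rewrite col_permE invgK mulmxA mul_mx_diag; congr (_ *m _).
  by apply: eq_pt; rewrite mxE !ptE.
case: b; apply: eq_pt; rewrite mxE /= ?perm1 ?tpermL ?tpermR ?ptE//.
by rewrite tpermD// ptE.
Qed.

Lemma pt_axis_mx_neq0 (c1 c2 c3 : R) : c1 != 0 -> c2 != 0 -> c3 != 0 ->
  forall k, pt c1 c2 c3 0 k != 0.
Proof. by move=> ? ? ?; apply: ord3P; rewrite ptE. Qed.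

(** A label [inl (b, e, s)] stands for the half pyramid along the x-axis
    ([b] false) or the y-axis ([b] true), on the side of sign [(-1) ^+ e], above
    or below the plane z = 0 according to [(-1) ^+ s]; a label [inr b] stands
    for one of the two halves of the cube. *)
Definition piece_mx i : 'M[R]_3 :=
  match i with
  | inl (b, e, s) => axis_mx (pt ((-1) ^+ e) 1 ((-1) ^+ s)) b
  | inr b => axis_mx (pt 1 1 1) b
  end.

Definition piece_shift i : point :=
  match i with
  | inl (b, e, s) => if b then pt 0 ((-1) ^+ e) 0 else pt ((-1) ^+ e) 0 0
  | inr b => 0
  end.

Definition model i : set point :=
  if i is inl _ then @wedge R else @prism R.

Definition piece i : set point := affine_map (piece_mx i) (piece_shift i) @` model i.

Lemma sign_neq0 b : (-1) ^+ b != 0 :> R.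
Proof. by rewrite signr_eq0. Qed.

Lemma piece_mx_axis i : axis_preserving (piece_mx i).
Proof.
case: i => [[[b e] s]|b]; apply: axis_preserving_monomial; apply: pt_axis_mx_neq0;
  by rewrite ?sign_neq0 ?oner_eq0.
Qed.

Lemma piece_mx_unit i : piece_mx i \in unitmx.
Proof.
case: i => [[[b e] s]|b]; apply: unitmx_monomial; apply: pt_axis_mx_neq0;
  by rewrite ?sign_neq0 ?oner_eq0.
Qed.

Lemma pentahedron_piece i : pentahedron (piece i).
Proof.
apply: pentahedron_affine_image; first exact: piece_mx_unit.
by case: i => ?; [exact: pentahedron_wedge|exact: pentahedron_prism].
Qed.

Lemma piece_boundary_connected i : orthogonally_connected (boundary (piece i)).
Proof.
rewrite boundary_affine_image; last exact: piece_mx_unit.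
apply: orthogonally_connected_affine_image; first exact: piece_mx_axis.
by case: i => ?; [exact: wedge_boundary_connected|exact: prism_boundary_connected].
Qed.

Definition piece_map_pt i x y z : point :=
  match i with
  | inl (b, e, s) => if b then pt y ((-1) ^+ e * (1 + x)) ((-1) ^+ s * z)
                     else pt ((-1) ^+ e * (1 + x)) y ((-1) ^+ s * z)
  | inr b => if b then pt y x z else pt x y z
  end.

Lemma piece_mapE i x y z :
  affine_map (piece_mx i) (piece_shift i) (pt x y z) = piece_map_pt i x y z.
Proof.
rewrite /affine_map; case: i => [[[[] e] s]|[]] /=; rewrite pt_axis_mx ?addr0 ?addpt;
by congr pt; ring.
Qed.

Lemma in_piece i x y z : model i (pt x y z) -> piece i (piece_map_pt i x y z).
Proof. by move=> mxyz; exists (pt x y z); rewrite ?piece_mapE. Qed.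

(** These few strict inequalities already separate the pieces. *)
Definition open_region i p : Prop :=
  match i with
  | inl (b, e, s) =>
      let: (u, w) := if b then (p 0 1, p 0 0) else (p 0 0, p 0 1) in
      [/\ 1 < (-1) ^+ e * u, -1 < w, w < 1 & 0 < (-1) ^+ s * p 0 2%:R]
  | inr b =>
      let: (u, w) := if b then (p 0 1, p 0 0) else (p 0 0, p 0 1) in
      [/\ -1 < w, w < u & u < 1]
  end.

Lemma interior_piece_region i p : (piece i)° p -> open_region i p.
Proof.
rewrite interior_affine_image; last exact: piece_mx_unit.
move=> [q + <-]; rewrite (pt_eta q) piece_mapE.
move: (q 0 0) (q 0 1) (q 0 2%:R) => x y z {p q}.
case: i => [[[b e] s]|b] /=.
  rewrite interior_hpolytope => [W|]; last exact: wedge_normal_neq0.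
  have := W (@Ordinal 5 0 isT); have := W (@Ordinal 5 1 isT).
  have := W (@Ordinal 5 3 isT); have := W (@Ordinal 5 4 isT).
  rewrite /= !dot_pt /wedge_bound /= => *.
  by case: b; rewrite !ptE; split; rewrite ?mulrA -?expr2 ?sqrr_sign; lra.
rewrite interior_hpolytope => [W|]; last exact: prism_normal_neq0.
have := W (@Ordinal 5 2 isT); have := W (@Ordinal 5 3 isT).
have := W (@Ordinal 5 4 isT).
rewrite /= !dot_pt /prism_bound /= => *.
by case: b; rewrite !ptE; split; lra.
Qed.

Lemma open_region_disjoint i j p : open_region i p -> open_region j p -> i = j.
Proof.
by case: i => [[[[] []] []]|[]]; case: j => [[[[] []] []]|[]] //=;
  rewrite ?expr0 ?expr1 => ip jp; exfalso; case: ip => ?; case: jp => *; lra.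
Qed.

(** * The turned cuboctahedron *)

(** The rotation by 45 degrees about the z-axis, times [Num.sqrt 2] in the
    horizontal directions so that all coordinates stay integral. *)
Definition turn_mx : 'M[R]_3 :=
  \matrix_(k < 3) nth 0 [:: pt 1 (-1) 0; pt 1 1 0; pt 0 0 1] k.

Lemma pt_turn_mx x y z : pt x y z *m turn_mx = pt (x + y) (y - x) z.
Proof. by apply: eq_pt; rewrite mxE sum3 !ptE !mxE /= ?ptE; ring. Qed.

Lemma vertex_xy a b : cuboctahedron_vertices (pt ((-1) ^+ a) ((-1) ^+ b) 0 : point).
Proof.
exists 1%g, a, b; rewrite col_perm1.
by apply: eq_pt; rewrite ?ptE ?mxE.
Qed.

Lemma vertex_xz a b : cuboctahedron_vertices (pt ((-1) ^+ a) 0 ((-1) ^+ b) : point).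
Proof.
exists (tperm 1 2%:R), a, b; apply: eq_pt; rewrite ?ptE !mxE.
- by rewrite tpermD.
- by rewrite tpermL.
- by rewrite tpermR.
Qed.

Lemma vertex_yz a b : cuboctahedron_vertices (pt 0 ((-1) ^+ a) ((-1) ^+ b) : point).
Proof.
exists (tperm 0 2%:R), b, a; apply: eq_pt; rewrite ?ptE !mxE.
- by rewrite tpermL.
- by rewrite tpermD.
- by rewrite tpermR.
Qed.

Definition turned : set point :=
  affine_map turn_mx 0 @` convex_hull (@cuboctahedron_vertices R).

Lemma convex_turned : @convex_set R point turned.
Proof. by apply: convex_affine_image; exact: convex_hull_convex. Qed.

Lemma in_turned x y z x' y' : cuboctahedron_vertices (pt x y z) ->
  x + y = x' -> y - x = y' -> turned (pt x' y' z).
Proof.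
move=> V <- <-; exists (pt x y z); first exact: sub_gen_smallest.
by rewrite /affine_map addr0 pt_turn_mx.
Qed.

Lemma turned_corner a b c : turned (pt ((-1) ^+ a) ((-1) ^+ b) ((-1) ^+ c)).
Proof.
have [<-|ab] := eqVneq a b.
  by apply: in_turned (vertex_yz a c) _ _; ring.
have -> : (-1) ^+ b = - (-1) ^+ a :> R.
  by case: a b ab => -[]; rewrite ?expr0 ?expr1 ?opprK.
by apply: in_turned (vertex_xz a c) _ _; ring.
Qed.

Lemma turned_apex_x a : turned (pt ((-1) ^+ a * 2) 0 0).
Proof. by apply: in_turned (vertex_xy a a) _ _; ring. Qed.

Lemma turned_apex_y a : turned (pt 0 ((-1) ^+ a * 2) 0).
Proof.
apply: in_turned (vertex_xy (~~ a) a) _ _; case: a => /=; rewrite ?expr0 ?expr1; ring.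
Qed.

(** These midpoints of vertical cube edges are vertices of pieces, but not of
    the solid. *)
Lemma turned_edge a b : turned (pt ((-1) ^+ a) ((-1) ^+ b) 0).
Proof.
apply: (convex_segment_pt convex_turned (t := 2^-1) _
  (turned_corner a b false) (turned_corner a b true)); rewrite /= ?expr0 ?expr1;
lra.
Qed.

Lemma piece_sub_turned i : piece i `<=` turned.
Proof.
have corner (u w v : R) : u \in [:: 1; -1] -> w \in [:: 1; -1] ->
    v \in [:: 1; 0; -1] -> turned (pt u w v).
  have sgn (t : R) : t \in [:: 1; -1] -> exists a : bool, t = (-1) ^+ a.
    by rewrite !inE => /orP[]/eqP->; [exists false|exists true].
  move=> /sgn[a ->] /sgn[b ->]; rewrite !inE => /or3P[]/eqP->.
  - exact: (turned_corner a b false).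
  - exact: turned_edge.
  - exact: (turned_corner a b true).
have sub (V : set point) : (forall p, V p ->
    turned (affine_map (piece_mx i) (piece_shift i) p)) -> model i = convex_hull V ->
    piece i `<=` turned.
  move=> VT mE; rewrite /piece mE; apply: image_convex_hull_subset convex_turned _.
  by move=> _ [p Vp <-]; exact: VT.
case: i sub => [[[b e] s]|b] sub.
  apply: (sub (@wedge_vertices R)); last exact: wedge_hull.
  move=> p {sub}; rewrite /wedge_vertices /= !inE.
  move=> /or4P[/eqP->|/eqP->|/eqP->|/orP[]/eqP->];
  rewrite (piece_mapE (inl (b, e, s))) /piece_map_pt;
  case: b; rewrite ?addr0 ?mulr1 ?mulr0;
  by [exact: turned_apex_x|exact: turned_apex_y|
      apply: corner; rewrite ?inE ?eqxx ?orbT//; case: e; case: s;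
      rewrite ?expr0 ?expr1 ?eqxx ?orbT].
apply: (sub (@prism_vertices R)); last exact: prism_hull.
move=> p {sub}; rewrite /prism_vertices /= !inE.
move=> /or4P[/eqP->|/eqP->|/eqP->|/or3P[]/eqP->];
rewrite (piece_mapE (inr b)) /piece_map_pt;
by case: b; apply: corner; rewrite ?inE ?eqxx ?orbT.
Qed.

Lemma vertex_norms p : cuboctahedron_vertices p ->
  (forall k, `|p 0 k| <= 1) /\ `|p 0 0| + `|p 0 1| + `|p 0 2%:R| = 2.
Proof.
move=> [s [a [b ->]]]; set r := \row_k _.
have rE : r = pt ((-1) ^+ a) ((-1) ^+ b) 0 by apply: eq_pt; rewrite ptE /r ?mxE.
split=> [k|].
  rewrite mxE rE; move: (s k); apply: ord3P; rewrite ptE ?normr_sign ?normr0//.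
have -> : `|col_perm s r 0 0| + `|col_perm s r 0 1| + `|col_perm s r 0 2%:R| =
    \sum_(k < 3) `|r 0 (s k)| by rewrite sum3 !mxE.
have <- : \sum_(k < 3) `|r 0 k| = \sum_(k < 3) `|r 0 (s k)|.
  by rewrite [LHS](reindex_perm s).
by rewrite sum3 rE !ptE !normr_sign normr0; ring.
Qed.

(** The vertices satisfy the inequalities of the cuboctahedron, hence so does
    their hull; [max (|u|, |w|)] becomes half the sum of [|u + w|] and
    [|w - u|]. *)
Lemma turned_bounds x y z : turned (pt x y z) ->
  [/\ `|x| + `|y| <= 2, `|x| + `|z| <= 2, `|y| + `|z| <= 2 & `|z| <= 1].
Proof.
pose B : set point := [set p | (forall k, `|p 0 k| <= 1) /\
  `|p 0 0| + `|p 0 1| + `|p 0 2%:R| <= 2].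
have cB : @convex_set R point B.
  apply/convexP => p q t /andP[t0 t1] [p1 p2] [q1 q2].
  have nrm k : `|(t *: p + (1 - t) *: q) 0 k| <= t * `|p 0 k| + (1 - t) * `|q 0 k|.
    rewrite !mxE; apply: le_trans (ler_normD _ _) _.
    by rewrite !normrM (ger0_norm t0) (@ger0_norm _ (1 - t)) ?subr_ge0.
  split=> [k|]; first by have := nrm k; have := p1 k; have := q1 k; nra.
  have := nrm 0; have := nrm 1; have := nrm 2%:R; nra.
move=> [p + pE]; have : convex_hull (@cuboctahedron_vertices R) `<=` B.
  apply: smallest_sub => // q /vertex_norms[q1 q2].
  by split=> //; rewrite q2.
move=> /[apply] -[]; move: pE; rewrite (pt_eta p) /affine_map addr0 pt_turn_mx.
move: (p 0 0) (p 0 1) (p 0 2%:R) => u w v /pt_inj[<- <- <-] n1.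
have := n1 0; have := n1 1; have := n1 2%:R; rewrite !ptE => {n1}.
case: (ger0P u) => ?; case: (ger0P w) => ?; case: (ger0P v) => ?;
case: (ger0P (u + w)) => ?; case: (ger0P (w - u)) => ? ? ? ? ?; split; lra.
Qed.

(** A point outside the cube lies beyond one of its vertical sides, and its
    signs then determine the half pyramid. *)
Lemma turnedE : turned = \bigcup_i piece i.
Proof.
apply/seteqP; split=> p; last by move=> [i _]; exact: piece_sub_turned.
rewrite (pt_eta p); move: (p 0 0) (p 0 1) (p 0 2%:R) => x y z {p}.
move=> /turned_bounds[xy xz yz z1].
have := ler_norm x; have := ler_norm y; have := ler_norm z.
have := ler_norm (- x); have := ler_norm (- y); have := ler_norm (- z).
rewrite !normrN => *; have := normr_ge0 z => ?.
have [x1|x1] := lerP 1 `|x|.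
  exists (inl (false, x < 0, z < 0)) => //.
  have -> : pt x y z = piece_map_pt (inl (false, x < 0, z < 0)) (`|x| - 1) y `|z|.
    by rewrite /= addrC subrK -!numEsign.
  by apply/in_piece/wedgeP; split; lra.
have [y1|y1] := lerP 1 `|y|.
  exists (inl (true, y < 0, z < 0)) => //.
  have -> : pt x y z = piece_map_pt (inl (true, y < 0, z < 0)) (`|y| - 1) x `|z|.
    by rewrite /= addrC subrK -!numEsign.
  by apply/in_piece/wedgeP; split; lra.
have [yx|yx] := lerP y x.
  exists (inr false) => //.
  by apply: (@in_piece (inr false) x y z); apply/prismP; split; lra.
exists (inr true) => //.
by apply: (@in_piece (inr true) y x z); apply/prismP; split; lra.
Qed.

Lemma decomposition_bij k (I : finType) C (P : I -> set point) : #|I| = k ->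
  (forall l : I, polytope (P l)) -> C = \bigcup_(l : I) P l ->
  trivIset setT (fun l : I => (P l)°) ->
  exists f : 'I_k -> I, decomposition C (P \o f).
Proof.
move=> <- Ppoly -> Ptriv; exists enum_val; split=> [i||].
- exact: Ppoly.
- apply/seteqP; split=> p [i _ Pip]; last by exists (enum_val i).
  by exists (enum_rank i) => //; rewrite /= enum_rankK.
- by move=> i j _ _ /= Pij; apply: enum_val_inj; apply: Ptriv.
Qed.

Lemma axis_mxZ (t : R) (d : point) b : axis_mx (t *: d) b = t *: axis_mx d b.
Proof. by rewrite /axis_mx linearZ/= -scalemxAl. Qed.

(** In odd dimension, multiplying an orthogonal matrix by its determinant, 1 or
    -1, makes it a rotation. *)
Lemma rotation_det_scale (N : 'M[R]_3) : orthogonal_mx N -> rotation_mx (\det N *: N).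
Proof.
move=> oN; have det2 : \det N * \det N = 1.
  by rewrite -{2}det_tr -det_mulmx oN det1.
split.
  by rewrite /orthogonal_mx linearZ/= -scalemxAl -scalemxAr scalerA det2 scale1r.
by rewrite detZ !exprS expr0 mulr1 -!mulrA det2 mulr1 det2.
Qed.

(** * The suitable rotation *)

Definition eighth_turn_mx : 'M[R]_3 :=
  turn_mx *m axis_mx (pt (Num.sqrt 2)^-1 (Num.sqrt 2)^-1 1) false.

Lemma orthogonal_eighth_turn : orthogonal_mx eighth_turn_mx.
Proof.
have s2 : (Num.sqrt 2)^-1 * (Num.sqrt 2)^-1 = 2^-1 :> R.
  by rewrite -invfM -expr2 sqr_sqrtr.
have rowE k : row k eighth_turn_mx = nth 0 [:: pt (Num.sqrt 2)^-1 (- (Num.sqrt 2)^-1) 0;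
    pt (Num.sqrt 2)^-1 (Num.sqrt 2)^-1 0; pt 0 0 1] k.
  rewrite row_mul rowK; move: k; apply: ord3P; rewrite pt_axis_mx; congr pt; ring.
apply/matrixP => k l.
have -> : (eighth_turn_mx *m eighth_turn_mx^T) k l =
    dot (row k eighth_turn_mx) (row l eighth_turn_mx).
  by rewrite mxE; apply: eq_bigr => u _; rewrite !mxE.
rewrite !rowE mxE; move: k l; apply: ord3P; apply: ord3P; rewrite /= dot_pt /=;
by rewrite ?mulrN ?mulNr ?mulr0 ?mul0r ?s2 ?opprK; lra.
Qed.

Lemma mulmx_orthogonal (M N : 'M[R]_3) :
  orthogonal_mx M -> orthogonal_mx N -> orthogonal_mx (M *m N).
Proof.
by move=> oM oN; rewrite /orthogonal_mx trmx_mul mulmxA -(mulmxA M) oN mulmx1.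
Qed.

End Dissection.

Theorem theorem5p2 (R : realType) (C : set 'rV[R]_3) :
  cuboctahedron C ->
  exists2 A : 'M[R]_3, rotation_mx A &
    exists P : 'I_10 -> set 'rV[R]_3,
      decomposition (rotate A C) P /\
      (forall i, pentahedron (P i) /\ orthogonally_connected (boundary (P i))).
Proof.
move=> [f [c [A [v [c0 oA fE]]]] ->].
have oAT : orthogonal_mx A^T by rewrite /orthogonal_mx trmxK; apply: mulmx1C.
(* The rotation undoes the orthogonal part of the similarity before turning; the
   sign it may bring in goes into the scaling factor [k]. *)
have oN := mulmx_orthogonal oAT (orthogonal_eighth_turn R).
set N := _ *m _ in oN; have := rotation_det_scale oN.
set M := _ *: N => rotM; exists M => //.
pose k := c * \det N; pose h := k * (Num.sqrt 2)^-1.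
have detN : \det N != 0.
  by apply/eqP => N0; have := rotM.2; rewrite /M N0 scale0r det0 => /eqP;
    rewrite eq_sym oner_eq0.
have k0 : k != 0 by rewrite mulf_neq0// gt_eqF.
have h0 : h != 0 by rewrite mulf_neq0// invr_eq0 sqrtr_eq0 -ltNge ltr0n.
pose L := axis_mx (pt h h k) false.
have L0 := pt_axis_mx_neq0 h0 h0 k0.
have uL : L \in unitmx by exact: unitmx_monomial.
have axL : axis_preserving L by exact: axis_preserving_monomial.
have CE : rotate M (f @` convex_hull (@cuboctahedron_vertices R)) =
    affine_map L (v *m M) @` (@turned R).
  rewrite /rotate /turned !image_comp; apply: eq_imagel => x _ /=.
  rewrite fE mulmxDl; congr (_ + _).
  have -> : L = k *: axis_mx (pt (Num.sqrt 2)^-1 (Num.sqrt 2)^-1 1) false.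
    by rewrite -axis_mxZ scalept mulr1.
  rewrite /M /affine_map addr0 -!scalemxAl -!scalemxAr scalerA; congr (_ *: _).
  by rewrite /N !mulmxA -(mulmxA x) oA mulmx1.
pose P i := affine_map L (v *m M) @` @piece R i.
set K := rotate M _ in CE *.
have [||||g dec] := @decomposition_bij _ 10 _ K P.
- by rewrite card_sum !card_prod card_bool.
- by move=> i; case: (pentahedron_affine_image (v *m M) uL (pentahedron_piece R i)).
- by rewrite CE turnedE image_bigcup.
- move=> i j _ _ [p []]; rewrite /P !(interior_affine_image (v *m M) _ uL).
  move=> [q qi <-] [q' q'j] /(affine_map_inj uL) q'q; rewrite q'q in q'j.
  exact: open_region_disjoint (interior_piece_region qi) (interior_piece_region q'j).
exists (P \o g); split=> // i; split.
  exact/pentahedron_affine_image/pentahedron_piece.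
rewrite /= boundary_affine_image//; apply: orthogonally_connected_affine_image => //.
exact: piece_boundary_connected.
Qed.
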